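(* Let $f_0\in L_2([0,1]^p)$. Suppose that for an $m\in\mathbb{N}_+$ and a $\delta>0$ the class of functions $\mathcal{F}_m(\delta)$ on $[0,1]^p$ satisfies, for some constant $\eta>0$, $$f\in\mathcal{F}_m(\delta)\ \Longrightarrow\ \|f-f_0\|_\infty^2\le \eta\left(m\|f-f_0\|_2^2+\delta^2\right).$$ Let $(\epsilon_n)_{n=1}^\infty$ be a sequence with $n\epsilon_n^2\to\infty$. Then there are constants $C>0$ and $\xi\in(0,1)$ (depending only on $\eta$ and $\sigma$) such that for any $M\ge 0$ there exists a sequence of test functions $(\phi_n)_{n=1}^\infty$ such that $$\mathbb{E}_0\phi_n\le \sum_{j=M}^\infty N_{nj}\exp\left(-Cnj^2\epsilon_n^2\right),$$ $$\sup_{\{f\in\mathcal{F}_m(\delta):\,\|f-f_0\|_2>M\epsilon_n\}}\mathbb{E}_f(1-\phi_n)\le \exp\left(-CM^2n\epsilon_n^2\right)+2\exp\left(-\frac{CM^2n\epsilon_n^2}{mM^2\epsilon_n^2+\delta^2}\right),$$ where $N_{nj}=\mathcal{N}(\xi j\epsilon_n,\mathcal{S}_{nj}(\epsilon_n),\|\cdot\|_2)$ is the covering number of $$\mathcal{S}_{nj}(\epsilon_n)=\left\{f\in\mathcal{F}_m(\delta):\ j\epsilon_n<\|f-f_0\|_2\le (j+1)\epsilon_n\right\},$$ and the sum runs over $j=M,M+1,M+2,\dots$.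
   Context: Random-design regression: $\mathbf{x}_1,\dots,\mathbf{x}_n$ are i.i.d. uniform on $[0,1]^p$ ($p$ fixed), $y_i=f(\mathbf{x}_i)+e_i$ with $e_i$ i.i.d. $\mathrm{N}(0,\sigma^2)$ independent of the design points, $\sigma^2>0$ known. The data are $\mathcal{D}_n=(\mathbf{x}_i,y_i)_{i=1}^n$. $\mathbb{E}_f$ denotes expectation when the regression function is $f$, i.e. the pairs $(\mathbf{x}_i,y_i)$ are i.i.d. with density $p_f(\mathbf{x},y)=\phi_\sigma(y-f(\mathbf{x}))$, where $\phi_\sigma$ is the $\mathrm{N}(0,\sigma^2)$ density; $\mathbb{E}_0=\mathbb{E}_{f_0}$. A test function is a measurable $\phi_n:([0,1]^p\times\mathbb{R})^n\to[0,1]$ evaluated at $\mathcal{D}_n$. $\|\cdot\|_2$ is the integrated $L_2$-norm on $[0,1]^p$ and $\|\cdot\|_\infty$ the sup-norm. For a metric space $(\mathcal{F},d)$, the covering number $\mathcal{N}(\epsilon,\mathcal{F},d)$ is the minimum number of $\epsilon$-balls $\{g\in\mathcal{F}:d(f,g)<\epsilon\}$ (with centers $f\in\mathcal{F}$) needed to cover $\mathcal{F}$. *)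

(* Defs.v *)
From HB Require Import structures.
From mathcomp Require Import all_boot all_order all_algebra.
From mathcomp Require Import all_classical all_reals all_analysis.

Set Implicit Arguments.
Unset Strict Implicit.
Unset Printing Implicit Defensive.

Import Order.TTheory GRing.Theory Num.Theory.
Import numFieldNormedType.Exports.

Local Open Scope classical_set_scope.
Local Open Scope ring_scope.
Local Open Scope ereal_scope.

Definition tuple_cons d (T : measurableType d) n (z : T * n.-tuple T) :
  n.+1.-tuple T := [the n.+1.-tuple T of z.1 :: z.2].

Lemma measurable_tuple_cons d (T : measurableType d) n :
  measurable_fun [set: T * n.-tuple T] (@tuple_cons d T n).
Proof. exact: measurable_cons. Qed.

HB.instance Definition _ d (T : measurableType d) n :=
  isMeasurableFun.Build _ _ _ _ (@tuple_cons d T n) (@measurable_tuple_cons d T n).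

(* The n-fold product P (x) ... (x) P, i.e. the law of n i.i.d. draws from P. *)
Fixpoint iid_prob d (T : measurableType d) (R : realType) (P : probability T R)
    (n : nat) : probability (n.-tuple T) R :=
  match n with
  | 0 => \d_([tuple] : 0.-tuple T)
  | n'.+1 => distribution (P \x iid_prob P n') (@tuple_cons d T n')
  end.

(* Minimal number of open balls of radius e, with centers in F, covering F;
   +oo when no finite family of such balls covers F. *)
Definition covering_number (R : realType) (T : Type) (e : R) (F : set T)
    (d : T -> T -> \bar R) : \bar R :=
  ereal_inf [set k%:R%:E | k in
    [set k : nat | exists c : 'I_k -> T, (forall i, F (c i)) /\
       forall g, F g -> exists i, d (c i) g < e%:E]].

Section Regression.
Variables (R : realType) (p : nat).

(* [measurableTypeR R] is R with the Borel sigma-algebra, in the form on which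
   the library defines Lebesgue measure and the measures derived from it. *)
Definition covariate : Type := p.-tuple (measurableTypeR R).

Definition obs : Type := covariate * measurableTypeR R.

Definition cube : set covariate :=
  [set x | forall i, (0 <= (tnth x i : R) <= 1)%R].

(* The uniform distribution on [0,1]^p, as a probability on R^p.
   A function on [0,1]^p is represented by a function on R^p whose values
   outside the cube are irrelevant: the two norms below and the law of the data
   do not depend on them. *)
Definition design : probability covariate R :=
  iid_prob (uniform_prob (@ltr01 R)) p.

(* [design] is Lebesgue measure restricted to the cube, so this is the
   integrated L2-norm on [0,1]^p. *)
Definition norm2 (f : covariate -> R) : \bar R := 'N[design]_2%:E[EFin \o f].

Definition dist2 (f g : covariate -> R) : \bar R := norm2 (f \- g)%R.

(* A genuine supremum over the cube, not an essential one. *)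
Definition norm_sup (f : covariate -> R) : \bar R :=
  ereal_sup [set `|f x|%:E | x in cube].

Definition shell (F : set (covariate -> R)) (f0 : covariate -> R) (e j : R) :
    set (covariate -> R) :=
  [set f | F f /\ (j * e)%:E < norm2 (f \- f0)%R <= ((j + 1) * e)%:E].

(* The law of ((x_1, e_1), ..., (x_n, e_n)): the pairs are i.i.d., and x_i is
   independent of e_i. *)
Definition design_noise (sigma : R) (n : nat) : probability (n.-tuple obs) R :=
  iid_prob (design \x normal_prob 0%R sigma) n.

(* The data (x_i, y_i) with y_i = f(x_i) + e_i, as a function of the (x_i, e_i). *)
Definition data (f : covariate -> R) (n : nat) (w : n.-tuple obs) : n.-tuple obs :=
  [tuple of [seq (z.1, f z.1 + z.2)%R | z <- w]].

(* E_f of a statistic phi of the data. *)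
Definition expect (sigma : R) (n : nat) (f : covariate -> R)
    (phi : n.-tuple obs -> R) : \bar R :=
  'E_(design_noise sigma n)[phi \o @data f n].

Definition is_test (n : nat) (phi : n.-tuple obs -> R) : Prop :=
  measurable_fun [set: n.-tuple obs] phi /\ forall D, (0 <= phi D <= 1)%R.

End Regression.

(* Main.v *)
Require Import Defs.
From mathcomp Require Import all_boot all_order all_algebra.
From mathcomp Require Import all_classical all_reals all_analysis.
From mathcomp Require Import measurable_realfun.
From mathcomp Require Import ring lra.

(* For a center f1 with h = f1 - f0 and D = ||h||_2^2, reject f0 when
     sum_i (h(x_i) (y_i - f0(x_i)) - h(x_i)^2 / 4 - D / 32) > 0.
   Both errors follow from Chernoff's bound, the exponential moment of the sum
   being the n-th power of that of one term.  Under f0, integrating out the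
   Gaussian noise with exponent 1 / (2 sigma^2) cancels the h^2 terms, which
   leaves exp (- n D / (64 sigma^2)) whatever the sup-norm of h.  Under an f with
   ||f - f1||_2 <= ||h||_2 / 8, the exponent must also be at most a constant over
   the bound B = eta (m D + delta^2) on h^2, because exp has to be linearized
   before integrating over the design; whence exp (- n D min(1/sigma^2, 1/B)) up
   to constants.
   The test of the theorem rejects when one of the tests attached to the centers
   of minimal covers of the shells does.  If some shell has no finite cover, the
   first bound is infinite and one always rejects. *)

Set Implicit Arguments.
Unset Strict Implicit.
Unset Printing Implicit Defensive.

Import Order.TTheory GRing.Theory Num.Theory.
Import numFieldNormedType.Exports.

Local Open Scope classical_set_scope.
Local Open Scope ring_scope.
Local Open Scope ereal_scope.

(** * Gaussian integrals *)

(** The Radon-Nikodym derivative of [normal_prob] and [normal_pdf] have the same integral over every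
    measurable set, hence agree almost everywhere. Nonnegativity of [f] stands in for
    integrability. *)
Lemma integral_normal_prob (R : realType) (m s : R)
    (f : measurableTypeR R -> \bar R) :
  measurable_fun [set: measurableTypeR R] f -> (forall x, 0 <= f x) ->
  \int[normal_prob m s]_x f x =
  \int[lebesgue_measure]_x (f x * (normal_pdf m s x)%:E).
Proof.
move=> mf f0; have dom := normal_prob_dominates m s.
have mpdf : measurable_fun [set: measurableTypeR R]
    (fun x => (normal_pdf m s x)%:E).
  by apply/measurable_EFinP; exact: (measurable_normal_pdf _ s).
rewrite -(Radon_Nikodym_SigmaFinite.change_of_variables dom)//.
apply: ge0_ae_eq_integral => //.
- apply: emeasurable_funM => //.
  exact: measurable_int (Radon_Nikodym_SigmaFinite.f_integrable dom).
- exact: emeasurable_funM.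
- by move=> x _; rewrite mule_ge0// Radon_Nikodym_SigmaFinite.f_ge0.
- by move=> x _; rewrite mule_ge0// lee_fin normal_pdf_ge0.
apply: ae_eqe_mul2l.
apply: integral_ae_eq => //.
  exact: Radon_Nikodym_SigmaFinite.f_integrable.
move=> E _ mE.
by rewrite -(Radon_Nikodym_SigmaFinite.f_integral dom).
Qed.

(** Completing the square: tilting the centered normal density by exp (t x) gives a constant times
    the normal density of mean t s^2, which integrates to one. *)
Lemma normal_mgf (R : realType) (s t : R) : s != 0%R ->
  \int[normal_prob 0 s]_(x in [set: measurableTypeR R]) (expR (t * x))%:E =
  (expR (t ^+ 2 * s ^+ 2 / 2))%:E.
Proof.
move=> s0.
have mexp : measurable_fun [set: measurableTypeR R]
    (fun x : measurableTypeR R => (expR (t * x))%:E).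
  by apply/measurable_EFinP; apply: measurableT_comp => //; apply: measurable_funM.
rewrite integral_normal_prob//.
have shift (x : measurableTypeR R) :
    (expR (t * x))%:E * (normal_pdf 0 s x)%:E =
    (expR (t ^+ 2 * s ^+ 2 / 2))%:E * (normal_pdf (t * s ^+ 2) s x)%:E.
  rewrite -!EFinM !normal_pdfE// /normal_fun !(mulrCA (expR _)) -!expRD.
  by congr (_ * expR _)%:E; field.
under eq_integral => x _ do rewrite shift.
rewrite ge0_integralZl//.
- by rewrite integral_normal_pdf mule1.
- by apply/measurable_EFinP; exact: (measurable_normal_pdf _ s).
- by move=> x _; rewrite lee_fin normal_pdf_ge0.

Qed.

(** * Independent samples: exponential moments and almost sure constraints *)

Lemma iid_probS d (T : measurableType d) (R : realType) (P : probability T R)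
    n (f : n.+1.-tuple T -> \bar R) :
  measurable_fun setT f -> (forall w, 0 <= f w) ->
  \int[iid_prob P n.+1]_w f w =
  \int[P]_z \int[iid_prob P n]_w f [tuple of z :: w].
Proof.
move=> mf f0.
rewrite /= ge0_integral_pushforward//=.
by rewrite fubini_tonelli1//; apply: measurableT_comp.
Qed.

Lemma measurable_sum_tuple d (T : measurableType d) (R : realType)
    (u : T -> R) n :
  measurable_fun setT u ->
  measurable_fun [set: n.-tuple T] (fun w => \sum_(z <- w) u z)%R.
Proof.
move=> mu.
under eq_fun do rewrite big_tuple.
apply: measurable_sum => i.
by apply: (measurableT_comp mu); exact: measurable_tnth.
Qed.

(** Induction on the sample size: by Tonelli the first draw is split off, and the exponential of the
    sum factors. *)
Lemma iid_mgf d (T : measurableType d) (R : realType) (P : probability T R)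
    (u : T -> R) n (a : R) :
  measurable_fun setT u -> \int[P]_z (expR (u z))%:E <= a%:E ->
  \int[iid_prob P n]_w (expR (\sum_(z <- w) u z))%:E <= (a ^+ n)%:E.
Proof.
move=> mu ua.
have mE k : measurable_fun [set: k.-tuple T]
    (fun w => (expR (\sum_(z <- w) u z))%:E).
  apply/measurable_EFinP; apply: measurableT_comp => //.
  exact: measurable_sum_tuple.
have E0 (x : R) : 0 <= (expR x)%:E by rewrite lee_fin expR_ge0.
elim: n => [|n IH].
  rewrite integral_dirac//=; last exact: mE.
  by rewrite diracT mul1e big_nil expR0 expr0.
rewrite iid_probS//.
have I0 : 0 <= \int[iid_prob P n]_w (expR (\sum_(z <- w) u z))%:E.
  exact: integral_ge0.
under eq_integral => z _.
  under eq_integral => w _ do rewrite big_cons expRD EFinM.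
  rewrite ge0_integralZl//; last exact: mE.
  over.
rewrite ge0_integralZr//; last first.
  by apply/measurable_EFinP; apply: measurableT_comp.
rewrite exprS EFinM; apply: lee_pmul => //; exact: integral_ge0.
Qed.

(** Chernoff's bound for any statistic below the exponential of the sum. It serves both errors: [X]
    is the test itself under f0, and one minus a test under the alternative. *)
Lemma iid_chernoff d (T : measurableType d) (R : realType) (P : probability T R)
    (u : T -> R) n (a : R) (X : n.-tuple T -> R) :
  measurable_fun setT u -> measurable_fun [set: n.-tuple T] X ->
  (forall w, 0 <= X w <= expR (\sum_(z <- w) u z))%R ->
  \int[P]_z (expR (u z))%:E <= a%:E ->
  'E_(iid_prob P n)[X] <= (a ^+ n)%:E.
Proof.
move=> mu mX uX ua; apply: le_trans (iid_mgf n mu ua).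
rewrite unlock; apply: ge0_le_integral => //.
- by move=> w _; rewrite lee_fin; have /andP[] := uX w.
- exact/measurable_EFinP.
- apply/measurable_EFinP; apply: measurableT_comp => //.
  exact: measurable_sum_tuple.
- by move=> w _; rewrite lee_fin; have /andP[] := uX w.
Qed.

(** The indicator of the product set [B] factors over the coordinates, so [B] has mass one by
    induction. *)
Lemma iid_prob_ae d (T : measurableType d) (R : realType) (P : probability T R)
    (A : set T) n : measurable A -> P A = 1 ->
  {ae iid_prob P n, forall w : n.-tuple T, forall i, A (tnth w i)}.
Proof.
move=> mA PA.
pose B k := [set w : k.-tuple T | forall i, A (tnth w i)].
have mB k : measurable (B k).
  have -> : B k = \bigcap_(i in [set: 'I_k]) ((@tnth k T)^~ i @^-1` A).
    by apply/seteqP; split => w /= h i; [move=> _|]; exact: h.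
  apply: fin_bigcap_measurable => // i _.
  by rewrite -[X in measurable X]setTI; apply: measurable_tnth.
have BS (z : T) k (w : k.-tuple T) :
    (\1_(B k.+1) [tuple of z :: w])%:E = (\1_A z)%:E * (\1_(B k) w)%:E :> \bar R.
  rewrite -EFinM !indicE -natrM mulnb; congr (_ %:R)%:E; congr nat_of_bool.
  apply/idP/andP; rewrite !inE /B/=.
    move=> h; split; first exact: (h ord0).
    by move=> i; have := h (lift ord0 i); rewrite tnthS.
  move=> [h0 h] i; case: (unliftP ord0 i) => [j|] ->; first by rewrite tnthS.
  by rewrite tnth0.
have PB : iid_prob P n (B n) = 1.
  elim: n => [|n IH].
    by rewrite /= diracE; have -> : [tuple] \in B 0%N by rewrite inE => -[].
  transitivity (\int[iid_prob P n.+1]_w (\1_(B n.+1) w)%:E).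
    by rewrite integral_indic ?setIT//; exact: mB.
  rewrite iid_probS//; last first.
    by apply/measurable_EFinP/measurable_indic; exact: mB.
  under eq_integral => z _.
    under eq_integral => w _ do rewrite BS.
    rewrite ge0_integralZl//; last first.
      by apply/measurable_EFinP/measurable_indic; exact: mB.
    rewrite integral_indic ?setIT//; last exact: mB.
    over.
  transitivity (\int[P]_z (\1_A z)%:E); last by rewrite integral_indic// setIT.
  by apply: eq_integral => z _; rewrite -[RHS]mule1; congr (_ * _).
exists (~` B n); split; first by apply: measurableC; exact: mB.
  by rewrite probability_setC ?PB ?subee//; exact: mB.
by move=> w h hB; apply: h.
Qed.

(** The sup-norm controls functions on the cube only; this lets pointwise bounds on the cube be
    integrated against [design]. *)
Lemma design_cube (R : realType) p : {ae design R p, forall x, cube x}.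
Proof.
pose I : set (measurableTypeR R) := `[0%R : R, 1%R]%classic.
have mI : measurable I by exact: (measurable_itv `[0%R : R, 1%R]).
have I1 : uniform_prob (@ltr01 R) I = 1.
  by rewrite /uniform_prob integral_uniform_pdf1.
apply: filterS (iid_prob_ae p mI I1) => x xI i.
by have := xI i; rewrite /I/= in_itv.
Qed.

(** With t = u - v, 1 + t <= exp t bounds the left side by 1 / (1 + u - v). The product (1 - u / 2 +
    2 v) (1 + u - v) equals 1 + u (1 - u) / 2 + v (1 - 2 v) + 5 u v / 2, which is at least 1 on this
    range. *)
Lemma expR_le_affine (R : realType) (u v : R) :
  (0 <= u <= 1 -> 0 <= v <= 2^-1 -> expR (- u + v) <= 1 - u / 2 + 2 * v)%R.
Proof.
move=> /andP[u0 u1] /andP[v0 v1].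
have pos : (0 < 1 + (u - v))%R by lra.
have : ((1 + (u - v)) * expR (- u + v) <= 1)%R.
  have -> : (- u + v = - (u - v))%R by ring.
  by rewrite expRN ler_pdivrMr ?expR_gt0// mul1r expR_ge1Dx.
rewrite -ler_pdivlMl// mulr1 => /le_trans; apply.
rewrite -[leLHS]mul1r ler_pdivrMr//.
have : (0 <= u * (1 - u))%R by rewrite mulr_ge0//; lra.
have : (0 <= v * (1 - 2 * v))%R by rewrite mulr_ge0//; lra.
have : (0 <= u * v)%R by rewrite mulr_ge0.
lra.
Qed.

(** * The test attached to one center and its two errors *)

Section regression.
Variables (R : realType) (p : nat) (s : R).
Hypothesis s_gt0 : (0 < s)%R.
Local Notation X := (covariate R p).
Implicit Types f g a b : X -> R.

(** Given the design point the exponent is affine in the noise, so [normal_mgf] integrates the noise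
    out and leaves an integral over the design alone. *)
Lemma noise_mgf a b :
  measurable_fun [set: X] a -> measurable_fun [set: X] b ->
  \int[design R p \x normal_prob 0%R s]_z (expR (a z.1 + b z.1 * z.2))%:E =
  \int[design R p]_x (expR (a x + b x ^+ 2 * s ^+ 2 / 2))%:E.
Proof.
move=> ma mb.
rewrite fubini_tonelli1//; last first.
  apply/measurable_EFinP; apply: measurableT_comp => //.
  apply: measurable_funD; first exact: measurableT_comp.
  by apply: measurable_funM; [exact: measurableT_comp|exact: measurable_snd].
apply: eq_integral => x _; rewrite /fubini_F/=.
under eq_integral => y _ do rewrite expRD EFinM.
rewrite ge0_integralZl//; first by rewrite normal_mgf ?gt_eqF// -EFinM -expRD.
by apply/measurable_EFinP; apply: measurableT_comp => //; exact: measurable_funM.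
Qed.

Lemma integral_design_cst (k : R) : \int[design R p]_x k%:E = k%:E.
Proof.
have dT : design R p [set: X] = 1 by exact: probability_setT.
by rewrite integral_cst// -[RHS]mule1; congr (_ * _).
Qed.

Lemma measurable_data f n :
  measurable_fun [set: X] f -> measurable_fun setT (@data R p f n).
Proof.
move=> mf; apply/measurable_fun_tnthP => i.
pose shift (z : obs R p) : obs R p := (z.1, f z.1 + z.2)%R.
have -> : (@tnth n (obs R p))^~ i \o @data R p f n =
    shift \o (@tnth n (obs R p))^~ i.
  apply/funext => w /=.
  by rewrite (tnth_nth (tnth w i)) /= (nth_map (tnth w i)) ?size_tuple// -tnth_nth.
apply: measurableT_comp; last exact: measurable_tnth.
have mS : measurable_fun [set: obs R p] (fun z => f z.1 + z.2 : R)%R.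
  apply: measurable_funD; first exact: measurableT_comp.
  exact: measurable_snd.
by apply/measurable_fun_pairP; split; [exact: measurable_fst|exact: mS].
Qed.

(* With h = f1 - f0, the penalty h^2 / 4 is what makes the conditional
   exponential moment given x, at exponent 1 / (2 s^2), free of h under f0. *)
Definition score f0 f1 (D : R) (z : obs R p) : R :=
  ((f1 z.1 - f0 z.1) * (z.2 - f0 z.1) - (f1 z.1 - f0 z.1) ^+ 2 / 4 - D / 32)%R.

Lemma measurable_score f0 f1 D :
  measurable_fun [set: X] f0 -> measurable_fun [set: X] f1 ->
  measurable_fun setT (score f0 f1 D).
Proof.
move=> mf0 mf1.
have m0 : measurable_fun [set: obs R p] (fun z => f0 z.1) by exact: measurableT_comp.
have m1 : measurable_fun [set: obs R p] (fun z => f1 z.1) by exact: measurableT_comp.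
have mh : measurable_fun [set: obs R p] (fun z => f1 z.1 - f0 z.1)%R.
  exact: measurable_funB.
apply: measurable_funB => //; apply: measurable_funB.
  by apply: measurable_funM => //; exact: measurable_funB.
by apply: measurable_funM => //; exact: measurable_funX.
Qed.

Definition lr_test f0 f1 (D : R) n (w : n.-tuple (obs R p)) : R :=
  (0 < \sum_(z <- w) score f0 f1 D z)%R%:R.

Lemma measurable_lr_test f0 f1 D n :
  measurable_fun [set: X] f0 -> measurable_fun [set: X] f1 ->
  measurable_fun setT (@lr_test f0 f1 D n).
Proof.
move=> mf0 mf1.
have -> : @lr_test f0 f1 D n = \1_((fun w : n.-tuple (obs R p) =>
    \sum_(z <- w) score f0 f1 D z)%R @^-1` `]0%R, +oo[).
  by apply/funext => w; rewrite indicE; congr (_ %:R); congr nat_of_bool;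
    apply/idP/idP; rewrite inE/= in_itv/= andbT.
apply: measurable_indic; rewrite -[X in measurable X]setTI.
by apply: measurable_sum_tuple => //; exact: measurable_score.
Qed.

Lemma sum_data f n (w : n.-tuple (obs R p)) (t : obs R p -> R) :
  (\sum_(z <- data f w) t z = \sum_(z <- w) t (z.1, f z.1 + z.2))%R.
Proof. by rewrite big_map. Qed.

Lemma lr_test_type1 f0 f1 D n :
  measurable_fun [set: X] f0 -> measurable_fun [set: X] f1 ->
  expect s f0 (@lr_test f0 f1 D n) <=
  (expR (- (n%:R * (D / (64 * s ^+ 2)))))%:E.
Proof.
move=> mf0 mf1; set lam := (2 * s ^+ 2)^-1%R.
have lam0 : (0 < lam)%R by rewrite invr_gt0 mulr_gt0// exprn_gt0.
pose u (z : obs R p) := (lam * score f0 f1 D (z.1, f0 z.1 + z.2))%R.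
have mh : measurable_fun [set: X] (f1 \- f0)%R by exact: measurable_funB.
pose a x : R := (- (lam * ((f1 \- f0) x ^+ 2 / 4 + D / 32)))%R.
pose b x : R := (lam * (f1 \- f0) x)%R.
have ma : measurable_fun [set: X] a.
  apply: measurableT_comp => //; apply: measurable_funM => //.
  apply: measurable_funD => //; apply: measurable_funM => //.
  exact: measurable_funX.
have mb : measurable_fun [set: X] b by exact: measurable_funM.
have uE : u = (fun z => a z.1 + b z.1 * z.2)%R.
  by apply/funext => z; rewrite /u /a /b /score/=; ring.
have -> : (expR (- (n%:R * (D / (64 * s ^+ 2)))) =
    expR (- (D / (64 * s ^+ 2))) ^+ n)%R.
  by rewrite -expRM_natl mulrN.
apply: (@iid_chernoff _ _ _ _ u).
- rewrite uE; apply: measurable_funD.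
    exact: measurableT_comp.
  by apply: measurable_funM; [exact: measurableT_comp|exact: measurable_snd].
- by apply: measurableT_comp; [exact: measurable_lr_test|exact: measurable_data].
- move=> w; rewrite /lr_test/= sum_data; set S := (\sum_(z <- w) _)%R.
  have -> : (\sum_(z <- w) u z = lam * S)%R by rewrite /S mulr_sumr.
  rewrite ler0n/=; case: (ltP 0%R S) => /= S0; last exact: expR_ge0.
  by rewrite -[leLHS]expR0 ler_expR mulr_ge0// ltW.
rewrite uE /= noise_mgf//.
(* For this [lam] the noise term is lam h^2 / 4, which cancels the penalty; the exponent no longer
   depends on x. *)
have e x : (a x + b x ^+ 2 * s ^+ 2 / 2 = - (D / (64 * s ^+ 2)))%R.
  by rewrite /a /b /lam; field; rewrite gt_eqF.
under eq_integral => x _ do rewrite e.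
by rewrite integral_design_cst.
Qed.

(** Stated for any test [phi] above the one of [f1], so that it applies to the union of the tests of
    all centers. The two upper bounds on [lam] control the noise variance and the linearization of
    the exponential, respectively. *)
Lemma lr_test_type2 f0 f1 f (D B V lam : R) n (phi : n.-tuple (obs R p) -> R) :
  measurable_fun [set: X] f0 -> measurable_fun [set: X] f1 ->
  measurable_fun [set: X] f -> is_test phi ->
  (forall w, lr_test f0 f1 D w <= phi w)%R ->
  \int[design R p]_x (((f1 x - f0 x) ^+ 2)%R)%:E = D%:E ->
  \int[design R p]_x (((f x - f1 x) ^+ 2)%R)%:E = V%:E ->
  (64 * V <= D)%R ->
  (forall x, cube x -> (f1 x - f0 x) ^+ 2 <= B)%R ->
  (forall x, cube x -> (f x - f0 x) ^+ 2 <= 3 * B)%R ->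
  (0 < lam)%R -> (2 * s ^+ 2 * lam <= 1)%R -> (16 * B * lam <= 1)%R ->
  expect s f (fun w => 1 - phi w)%R <= (expR (- (n%:R * (lam * D / 16))))%:E.
Proof.
move=> mf0 mf1 mf [mphi phi01] lphi hD hV VD hB gB lam0 lams lamB.
pose u (z : obs R p) := (- (lam * score f0 f1 D (z.1, f z.1 + z.2)))%R.
have mh : measurable_fun [set: X] (f1 \- f0)%R by exact: measurable_funB.
have mg : measurable_fun [set: X] (f \- f0)%R by exact: measurable_funB.
have mH : measurable_fun [set: X] (f \- f1)%R by exact: measurable_funB.
pose a x : R := (- (lam * ((f1 \- f0) x * (f \- f0) x -
   (f1 \- f0) x ^+ 2 / 4 - D / 32)))%R.
pose b x : R := (- (lam * (f1 \- f0) x))%R.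
have ma : measurable_fun [set: X] a.
  apply: measurableT_comp => //; apply: measurable_funM => //.
  apply: measurable_funB => //; apply: measurable_funB => //.
    exact: measurable_funM.
  by apply: measurable_funM => //; exact: measurable_funX.
have mb : measurable_fun [set: X] b.
  by apply: measurableT_comp => //; exact: measurable_funM.
have uE : u = (fun z => a z.1 + b z.1 * z.2)%R.
  by apply/funext => z; rewrite /u /a /b /score/=; ring.
have -> : (expR (- (n%:R * (lam * D / 16))) = expR (- (lam * D / 16)) ^+ n)%R.
  by rewrite -expRM_natl mulrN.
apply: (@iid_chernoff _ _ _ _ u).
- rewrite uE; apply: measurable_funD.
    exact: measurableT_comp.
  by apply: measurable_funM; [exact: measurableT_comp|exact: measurable_snd].
- apply: (@measurableT_comp _ _ _ _ _ _ (fun w => 1 - phi w)%R).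
    exact: measurable_funB.
  exact: measurable_data.
- move=> w /=; have /andP[p0 p1] := phi01 (data f w).
  rewrite subr_ge0 p1/=.
  have := lphi (data f w); rewrite /lr_test sum_data.
  set S := (\sum_(z <- w) _)%R.
  have -> : (\sum_(z <- w) u z = - (lam * S))%R.
    by rewrite /S mulr_sumr -sumrN.
  case: (ltP 0%R S) => /= S0 lp.
    by apply: le_trans (expR_ge0 _); rewrite subr_le0.
  apply: (@le_trans _ _ 1%R); first by rewrite gerBl.
  by rewrite -[leLHS]expR0 ler_expR oppr_ge0 mulr_ge0_le0// ltW.
rewrite uE /= noise_mgf//.
(* Pointwise, a x + (b x s)^2 / 2 <= - lam h^2 / 4 + lam (f - f1)^2 + lam D / 32.
   In [key] the negative term of the linearized exponential is moved to the
   left, so that only nonnegative functions get integrated. *)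
pose K : R := expR (lam * D / 32).
pose E x : R := expR (a x + b x ^+ 2 * s ^+ 2 / 2).
have K0 : (0 <= K)%R by exact: expR_ge0.
have mE : measurable_fun [set: X] E.
  apply: measurableT_comp => //; apply: measurable_funD => //.
  by do 2 apply: measurable_funM => //; exact: measurable_funX.
have key x : cube x ->
    (E x + lam / 8 * K * (f1 x - f0 x) ^+ 2 <=
     K + 2 * lam * K * (f x - f1 x) ^+ 2)%R.
  move=> cx; have := hB x cx; have := gB x cx; rewrite /E /a /b /=.
  set h := (f1 x - f0 x)%R; set g := (f x - f0 x)%R.
  have -> : (f x - f1 x = g - h)%R by rewrite /g /h; ring.
  move=> gx hx.
  have h2 : (0 <= h ^+ 2)%R by exact: sqr_ge0.
  have H2 : (0 <= (g - h) ^+ 2)%R by exact: sqr_ge0.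
  have lh : (lam * h ^+ 2 <= lam * B)%R by rewrite ler_pM2l.
  have lg : (lam * g ^+ 2 <= lam * (3 * B))%R by rewrite ler_pM2l.
  have lh0 : (0 <= lam * h ^+ 2)%R by rewrite mulr_ge0// ltW.
  have lgh : (0 <= lam * (g + h) ^+ 2)%R by rewrite mulr_ge0 ?sqr_ge0// ltW.
  have lH0 : (0 <= lam * (g - h) ^+ 2)%R by rewrite mulr_ge0// ltW.
  (* This is - h (g - h) <= h^2 / 4 + (g - h)^2, which replaces the cross term of h g = h^2 + h (g -
     h). Next, [ls] bounds the noise term by lam h^2 / 4. *)
  have lc : (0 <= lam * (h / 2 + (g - h)) ^+ 2)%R.
    by rewrite mulr_ge0 ?sqr_ge0// ltW.
  have ls : (2 * s ^+ 2 * lam * (lam * h ^+ 2) <= lam * h ^+ 2)%R.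
    by rewrite -[leRHS]mul1r ler_wpM2r.
  have : (E x <= K * expR (- (lam * h ^+ 2 / 4) + lam * (g - h) ^+ 2))%R.
    rewrite -expRD ler_expR /a /b /= -/h -/g.
    lra.
  have : (expR (- (lam * h ^+ 2 / 4) + lam * (g - h) ^+ 2) <=
      1 - (lam * h ^+ 2 / 4) / 2 + 2 * (lam * (g - h) ^+ 2))%R.
    (* By [lgh], (g - h)^2 <= 2 g^2 + 2 h^2 <= 8 B, so 16 B lam <= 1 keeps lam (g - h)^2 below
       1/2. *)
    apply: expR_le_affine; lra.
  move=> /(ler_wpM2l K0) e1 e2; have := le_trans e2 e1.
  rewrite /E /a /b /= -/h -/g; lra.
have m2 (c : R) (t : X -> R) : measurable_fun [set: X] t ->
    measurable_fun [set: X] (fun x => (c * t x ^+ 2)%:E).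
  move=> mt; apply/measurable_EFinP; apply: measurable_funM => //.
  exact: measurable_funX.
have int2 (c v : R) (t : X -> R) : (0 <= c)%R -> measurable_fun [set: X] t ->
    \int[design R p]_x (t x ^+ 2)%:E = v%:E ->
    \int[design R p]_x (c * t x ^+ 2)%:E = (c * v)%:E.
  move=> c0 mt tv; under eq_integral => x _ do rewrite EFinM.
  rewrite ge0_integralZl//; first by rewrite tv.
  - by apply/measurable_EFinP; exact: measurable_funX.
  - by move=> x _; rewrite lee_fin sqr_ge0.
have c1 : (0 <= lam / 8 * K)%R by rewrite mulr_ge0// divr_ge0// ltW.
have c2 : (0 <= 2 * lam * K)%R by rewrite !mulr_ge0// ltW.
have : \int[design R p]_x ((E x)%:E + (lam / 8 * K * (f1 \- f0) x ^+ 2)%:E) <=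
    \int[design R p]_x (K%:E + (2 * lam * K * (f \- f1) x ^+ 2)%:E).
  apply: ae_ge0_le_integral => //.
  - by move=> x _; rewrite -EFinD lee_fin addr_ge0 ?expR_ge0// mulr_ge0 ?sqr_ge0.
  - by apply: emeasurable_funD; [exact/measurable_EFinP|exact: m2].
  - by move=> x _; rewrite -EFinD lee_fin addr_ge0 ?expR_ge0// mulr_ge0 ?sqr_ge0.
  - by apply: emeasurable_funD => //; exact: m2.
  - apply: filterS (@design_cube R p) => x cx _.
    by rewrite -!EFinD lee_fin; exact: key.
rewrite ge0_integralD//; last 4 first.
- by move=> x _; rewrite lee_fin expR_ge0.
- exact/measurable_EFinP.
- by move=> x _; rewrite lee_fin mulr_ge0 ?sqr_ge0.
- exact: m2.
rewrite ge0_integralD//; last 2 first.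
- by move=> x _; rewrite lee_fin mulr_ge0 ?sqr_ge0.
- exact: m2.
rewrite integral_design_cst (int2 _ D)// (int2 _ V)//.
rewrite -leeBrDr// -!EFinD => /le_trans; apply; rewrite lee_fin.
(* Since 64 V <= D, the linear terms add up to at most (1/32 - 1/8) lam D = - 3 lam D / 32. The
   factor [K] gives back lam D / 32, which leaves - lam D / 16. *)
have : (K * (1 - 3 * (lam * D / 32)) <= K * expR (- (3 * (lam * D / 32))))%R.
  by rewrite ler_wpM2l// expR_ge1Dx.
have -> : (K * expR (- (3 * (lam * D / 32))) = expR (- (lam * D / 16)))%R.
  by rewrite /K -expRD; congr expR; field.
apply: le_trans.
have : (0 <= 2 * lam * K / 64 * (D - 64 * V))%R.
  by rewrite mulr_ge0 ?divr_ge0// subr_ge0.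
lra.
Qed.

End regression.

(** * Covering numbers and L2 norms as real numbers *)

(** The infimum over an empty set is +oo, so some finite cover exists here, and a nonempty set of
    naturals has a least element: the infimum is attained by an actual cover. *)
Lemma covering_numberP (R : realType) (T : Type) (e : R) (F : set T)
    (d : T -> T -> \bar R) : covering_number e F d != +oo ->
  exists N : nat, exists c : 'I_N -> T,
    [/\ covering_number e F d = N%:R%:E, (forall i, F (c i)) &
        forall g, F g -> exists i, d (c i) g < e%:E].
Proof.
set A := [set k : nat | exists c : 'I_k -> T, (forall i, F (c i)) /\
  forall g, F g -> exists i, d (c i) g < e%:E].
move=> fin.
have [k0 Ak0] : exists k, `[< A k >].
  apply: contrapT => /forallNP A0; move/eqP: fin; apply.
  apply/ereal_inf_pinfty => x [k Ak _].
  by case: (A0 k); exact/asboolP.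
have exA : exists k, `[< A k >] by exists k0.
have [N /asboolP[c [cF cc]] minN] := ex_minnP exA.
exists N, c; split => //; apply/eqP; rewrite eq_le; apply/andP; split.
  by apply: ereal_inf_lbound; exists N => //; exists c.
apply: le_ereal_inf_tmp => _ [k Ak <-].
by rewrite lee_fin ler_nat minN//; apply/asboolP.
Qed.

Lemma covering_number_ge0 (R : realType) (T : Type) (e : R) (F : set T)
    (d : T -> T -> \bar R) : 0 <= covering_number e F d.
Proof. by apply: le_ereal_inf_tmp => _ [k _ <-]; rewrite lee_fin. Qed.

Section L2.
Variables (R : realType) (p : nat).
Local Notation X := (covariate R p).
Implicit Types f g : X -> R.

Lemma Lfun_measurable f :
  f \in Lfun (design R p) 2%:E -> measurable_fun [set: X] f.
Proof. by move=> /sub_Lfun_mfun; rewrite inE. Qed.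

Lemma Lfun_sub f g : f \in Lfun (design R p) 2%:E ->
  g \in Lfun (design R p) 2%:E -> (f \- g)%R \in Lfun (design R p) 2%:E.
Proof.
move=> Lf Lg.
have two : (1 <= 2%:E :> \bar R) by rewrite lee_fin ler1n.
have [_ /(_ (-1)%R g f Lg Lf)] := Lfun_submod_closed (design R p) two.
by rewrite scaleN1r addrC.
Qed.

(** Turns the extended-real norm into a real number and an integral of a square, the form in which
    the error bounds take their data. *)
Lemma norm2_sqr f : f \in Lfun (design R p) 2%:E -> exists r : R,
  [/\ (0 <= r)%R, norm2 f = r%:E &
      \int[design R p]_x (f x ^+ 2)%:E = (r ^+ 2)%:E].
Proof.
move=> Lf.
have nfin : norm2 f \is a fin_num.
  rewrite ge0_fin_numE ?Lnorm_ge0//.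
  by have := sub_Lfun_finLfun Lf; rewrite inE.
exists (fine (norm2 f)); split; first by rewrite fine_ge0 ?Lnorm_ge0.
  by rewrite fineK.
rewrite -powR_mulrn ?fine_ge0 ?Lnorm_ge0// -poweR_EFin fineK//.
rewrite /norm2 poweR_Lnorm//; apply: eq_integral => x _ /=.
by rewrite powR_mulrn// real_normK// num_real.
Qed.

Lemma norm_sup_sqr_le f (c : R) x :
  norm_sup f ^+ 2 <= c%:E -> cube x -> (f x ^+ 2 <= c)%R.
Proof.
move=> fc cx; rewrite -lee_fin; apply: le_trans fc.
have xs : `|f x|%:E <= norm_sup f by apply: ereal_sup_ubound; exists x.
rewrite -[X in X%:E](real_normK (num_real _)) EFin_expe !expe2.
by apply: lee_pmul => //; rewrite lee_fin.
Qed.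

(** Integrates (a + b)^2 <= 2 a^2 + 2 b^2. When 64 V <= D it yields G <= 3 D, the origin of the
    factor 3 in [lr_test_type2]. *)
Lemma integral_sqr_sub_le f0 f1 f (D V G : R) :
  measurable_fun [set: X] f0 -> measurable_fun [set: X] f1 ->
  measurable_fun [set: X] f ->
  \int[design R p]_x ((f1 x - f0 x) ^+ 2)%:E = D%:E ->
  \int[design R p]_x ((f x - f1 x) ^+ 2)%:E = V%:E ->
  \int[design R p]_x ((f x - f0 x) ^+ 2)%:E = G%:E ->
  (G <= 2 * D + 2 * V)%R.
Proof.
move=> m0 m1 m hD hV hG; rewrite -lee_fin EFinD !EFinM -hD -hV -hG.
have msq (a b : X -> R) : measurable_fun [set: X] a -> measurable_fun [set: X] b ->
    measurable_fun [set: X] (fun x => ((a x - b x) ^+ 2)%:E).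
  move=> ma mb; apply/measurable_EFinP; apply: measurable_funX.
  exact: measurable_funB.
have sq0 (a b : X -> R) (x : X) : 0 <= ((a x - b x) ^+ 2)%:E :> \bar R.
  by rewrite lee_fin sqr_ge0.
rewrite -!ge0_integralZl//; [|exact: msq..].
rewrite -ge0_integralD//; last 4 first.
- by move=> x _; rewrite mule_ge0.
- by apply: emeasurable_funM => //; exact: msq.
- by move=> x _; rewrite mule_ge0.
- by apply: emeasurable_funM => //; exact: msq.
apply: ge0_le_integral => //.
- exact: msq.
- by apply: emeasurable_funD; apply: emeasurable_funM => //; exact: msq.
move=> x _; rewrite -!EFinM -EFinD lee_fin.
have := sqr_ge0 ((f1 x - f0 x) - (f x - f1 x)); lra.
Qed.

End L2.

(** * Comparison of rates, union bound, decomposition into shells *)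

(** Each value of [lam] is absorbed by one term on the right: 1 / (2 s^2) by the first exponential,
    the sup-norm value by the second. In the latter case one passes from [D] to [x] because t / (m t
    + d2) is nondecreasing in t. *)
Lemma type2_rate (R : realType) (s eta C m d2 x D n lam : R) :
  (0 < s)%R -> (0 < eta)%R -> (0 <= m)%R -> (0 < d2)%R -> (0 <= n)%R ->
  (0 <= C)%R -> (C <= (64 * s ^+ 2)^-1)%R -> (C <= (256 * eta)^-1)%R ->
  (0 <= x <= D)%R ->
  (lam = (2 * s ^+ 2)^-1 \/ lam = (16 * (eta * (m * D + d2)))^-1)%R ->
  (expR (- (n * (lam * D / 16))) <=
   expR (- (n * (C * x))) + 2 * expR (- (n * (C * (x / (m * x + d2))))))%R.
Proof.
move=> s0 eta0 m0 d0 n0 C0 Cs Ceta /andP[x0 xD].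
have D0 : (0 <= D)%R by exact: le_trans xD.
have e0 (t : R) : (0 <= expR t)%R by exact: expR_ge0.
have s2 : (0 < s ^+ 2)%R by rewrite exprn_gt0.
case=> ->.
  apply: (@le_trans _ _ (expR (- (n * (C * x)))))%R.
    rewrite ler_expR lerN2 ler_wpM2l//.
    have : (C * x <= (64 * s ^+ 2)^-1 * D)%R by exact: ler_pM.
    move=> /le_trans; apply.
    have -> : ((2 * s ^+ 2)^-1 * D / 16 = 2 * ((64 * s ^+ 2)^-1 * D))%R.
      by field; rewrite gt_eqF.
    by rewrite ler_peMl ?ler1n// mulr_ge0// invr_ge0 mulr_ge0// ltW.
  by rewrite lerDl mulr_ge0.
have mx : (0 < m * x + d2)%R by rewrite ltr_wpDl// mulr_ge0.
have mD : (0 < m * D + d2)%R by rewrite ltr_wpDl// mulr_ge0.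
apply: (@le_trans _ _ (expR (- (n * (C * (x / (m * x + d2)))))))%R; last first.
  apply: (@le_trans _ _ (2 * expR (- (n * (C * (x / (m * x + d2))))))%R).
    by rewrite ler_peMl ?ler1n.
  by rewrite lerDr.
rewrite ler_expR lerN2 ler_wpM2l//.
have -> : ((16 * (eta * (m * D + d2)))^-1 * D / 16 =
    (256 * eta)^-1 * (D / (m * D + d2)))%R.
  by field; rewrite !gt_eqF.
apply: ler_pM => //; first by rewrite divr_ge0// ltW.
rewrite ler_pdivrMr// mulrAC ler_pdivlMr//.
have : (0 <= d2 * (D - x))%R by rewrite mulr_ge0 ?subr_ge0// ltW.
lra.
Qed.

Lemma expect_cst (R : realType) p (s : R) n (f : covariate R p -> R) (c : R) :
  expect s f (fun _ : n.-tuple (obs R p) => c) = c%:E.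
Proof. exact: expectation_cst. Qed.

(** Union bound: wherever [phi] is positive some term of the double sum is 1, so the sum dominates
    [phi] pointwise. Series and integral are exchanged by nonnegativity. *)
Lemma expect_le_series (R : realType) p (s : R) n (f : covariate R p -> R)
    (phi : n.-tuple (obs R p) -> R) (N : nat -> nat)
    (psi : forall k, 'I_(N k) -> n.-tuple (obs R p) -> R) :
  measurable_fun [set: covariate R p] f -> is_test phi ->
  (forall k i, is_test (@psi k i)) ->
  (forall w, (0 < phi w)%R -> exists k i, @psi k i w = 1%R) ->
  expect s f phi <= \sum_(0 <= k <oo) \sum_(i < N k) expect s f (@psi k i).
Proof.
move=> mf [mphi phi01] tpsi cover.
have md : measurable_fun setT (@data R p f n) by exact: measurable_data.
have mpsi k i : measurable_fun setT (EFin \o (@psi k i \o @data R p f n)).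
  have [mp _] := tpsi k i.
  by apply/measurable_EFinP; exact: measurableT_comp.
have psi0 k i w : 0 <= (@psi k i w)%:E.
  by rewrite lee_fin; have [_ /(_ w)/andP[]] := tpsi k i.
have -> : \sum_(0 <= k <oo) \sum_(i < N k) expect s f (@psi k i) =
    \int[design_noise p s n]_w
      \sum_(0 <= k <oo) \sum_(i < N k) (@psi k i (data f w))%:E.
  rewrite integral_nneseries//; last 2 first.
  - by move=> k; apply: emeasurable_sum => i; exact: mpsi.
  - by move=> k w _; apply: sume_ge0 => i _; exact: psi0.
  apply: eq_eseriesr => k _; rewrite ge0_integral_sum//.
  - by apply: eq_bigr => i _; rewrite /expect unlock.
  - by move=> i; exact: mpsi.
rewrite /expect unlock; apply: ge0_le_integral => //.
- by move=> w _; rewrite lee_fin; have /andP[] := phi01 (data f w).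
- by apply/measurable_EFinP; exact: measurableT_comp.
- apply: ge0_emeasurable_sum => [k w _ _|k _].
    by apply: sume_ge0 => i _; exact: psi0.
  by apply: emeasurable_sum => i; exact: mpsi.
move=> w _ /=; have /andP[p0 p1] := phi01 (data f w).
have g0 k : 0 <= \sum_(i < N k) (@psi k i (data f w))%:E.
  by apply: sume_ge0 => j _; exact: psi0.
move: p0; rewrite le_eqVlt => /predU1P[<-|].
  by apply: nneseries_ge0 => k _ _; exact: g0.
move=> /cover[k [i psi1]].
rewrite (nneseriesD1 (n := k))//; last by move=> j _; exact: g0.
rewrite (bigD1 i)//= psi1.
apply: (@le_trans _ _ 1); first by rewrite lee_fin.
rewrite -addeA leeDl// adde_ge0//; first by apply: sume_ge0 => j _; exact: psi0.
by apply: nneseries_ge0 => j _ _; exact: g0.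
Qed.

(** Take the least k satisfying the upper bound. The lower bound is the hypothesis if k = 0, and
    follows from minimality otherwise. *)
Lemma archimedean_shell (R : realType) (M e r : R) : (0 < e)%R -> (M * e < r)%R ->
  exists k : nat, ((M + k%:R) * e < r <= (M + k%:R + 1) * e)%R.
Proof.
move=> e0 Mr.
have exk : exists k : nat, (r <= (M + k%:R + 1) * e)%R.
  exists (Num.bound `|r / e - M|%R); rewrite -ler_pdivrMr//.
  have := archi_boundP (normr_ge0 (r / e - M)%R); have := ler_norm (r / e - M)%R.
  lra.
have [k rk mink] := ex_minnP exk; exists k; rewrite rk andbT.
case: k rk mink => [|k] rk mink; first by rewrite addr0.
rewrite ltNge; apply/negP => rle.
have : (k < k)%N; last by rewrite ltnn.
apply: mink; apply: le_trans rle _; rewrite -natr1 addrA.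
by [].
Qed.

(** The first entry is the rate of [lr_test_type1]. The second is the rate lam D / 16 of
    [lr_test_type2] at lam = 1 / (16 B), with B proportional to [eta]. *)
Definition rate_const (R : realType) (s eta : R) : R :=
  Num.min (64 * s ^+ 2)^-1%R (256 * eta)^-1%R.

Lemma rate_const_gt0 (R : realType) (s eta : R) :
  (0 < s)%R -> (0 < eta)%R -> (0 < rate_const s eta)%R.
Proof.
by move=> s0 eta0; rewrite lt_min !invr_gt0 !mulr_gt0// exprn_gt0.
Qed.

(** * The combined test for one sample size *)

Section separation.
Variables (R : realType) (s eta : R) (p m : nat) (delta : R).
Variables (f0 : covariate R p -> R) (F : set (covariate R p -> R)).
Hypothesis s_gt0 : (0 < s)%R.
Hypothesis eta_gt0 : (0 < eta)%R.
Hypothesis delta_gt0 : (0 < delta)%R.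
Hypothesis Lf0 : f0 \in Lfun (design R p) 2%:E.
Hypothesis LF : forall f, F f -> f \in Lfun (design R p) 2%:E.
Hypothesis supF : forall f, F f ->
  norm_sup (f \- f0)%R ^+ 2 <=
  eta%:E * (m%:R%:E * norm2 (f \- f0)%R ^+ 2 + (delta ^+ 2)%:E).
Local Notation C := (rate_const s eta).

Lemma sup_sqr_le f r x : F f -> norm2 (f \- f0)%R = r%:E -> cube x ->
  ((f x - f0 x) ^+ 2 <= eta * (m%:R * r ^+ 2 + delta ^+ 2))%R.
Proof.
move=> Ff fr cx; have := supF Ff.
by rewrite fr -EFin_expe -EFinM => /norm_sup_sqr_le; apply.
Qed.

(** Here [r] is the distance of the center [f1] from f0 and [x] a smaller radius, later M e, in
    which the bound is expressed uniformly over centers. The ratio 1/8 gives the condition 64 V <=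
    D. *)
Lemma ball_type2 (f1 f : covariate R p -> R) (r x : R) n
    (phi : n.-tuple (obs R p) -> R) :
  F f1 -> F f -> (0 <= x <= r)%R -> norm2 (f1 \- f0)%R = r%:E ->
  dist2 f1 f < (8^-1 * r)%:E ->
  is_test phi -> (forall w, lr_test f0 f1 (r ^+ 2) w <= phi w)%R ->
  expect s f (fun w => 1 - phi w)%R <=
  (expR (- (n%:R * (C * x ^+ 2))) +
   2 * expR (- (n%:R * (C * (x ^+ 2 / (m%:R * x ^+ 2 + delta ^+ 2))))))%:E.
Proof.
move=> F1 Ff /andP[x0 xr] n1 d1 tphi lphi.
have L1 := LF F1; have L := LF Ff.
have mf0 := Lfun_measurable Lf0.
have mf1 := Lfun_measurable L1.
have mf := Lfun_measurable L.
have r0 : (0 <= r)%R by exact: le_trans xr.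
have [r1 [r10 r1E D]] := norm2_sqr (Lfun_sub L1 Lf0).
have [v [v0 vE V']] := norm2_sqr (Lfun_sub L1 L).
have [g [g0 gE G]] := norm2_sqr (Lfun_sub L Lf0).
have r1r : r1 = r by move: r1E; rewrite n1 => -[].
subst r1.
have vr : (v < 8^-1 * r)%R by move: d1; rewrite /dist2 vE lte_fin.
have V : \int[design R p]_x ((f x - f1 x) ^+ 2)%:E = (v ^+ 2)%:E.
  by rewrite -V'; apply: eq_integral => y _ /=; rewrite -sqrrN opprB.
have v2 : (64 * v ^+ 2 <= r ^+ 2)%R.
  have : (v ^+ 2 <= (8^-1 * r) ^+ 2)%R by rewrite lerXn2r ?nnegrE ?mulr_ge0// ltW.
  by rewrite exprMn; lra.
have g2 : (g ^+ 2 <= 2 * r ^+ 2 + 2 * v ^+ 2)%R by exact: integral_sqr_sub_le D V G.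
pose B : R := (eta * (m%:R * r ^+ 2 + delta ^+ 2))%R.
have mr0 : (0 <= m%:R * r ^+ 2)%R by rewrite mulr_ge0 ?sqr_ge0.
have d20 : (0 < delta ^+ 2)%R by rewrite exprn_gt0.
have B0 : (0 < B)%R by rewrite mulr_gt0// ltr_wpDl.
(* The largest exponent that [lr_test_type2] admits. *)
pose lam := Num.min (2 * s ^+ 2)^-1%R (16 * B)^-1%R.
have s2 : (0 < 2 * s ^+ 2)%R by rewrite mulr_gt0// exprn_gt0.
have B16 : (0 < 16 * B)%R by rewrite mulr_gt0.
have lam0 : (0 < lam)%R by rewrite lt_min !invr_gt0 s2.
have : expect s f (fun w => 1 - phi w)%R <=
    (expR (- (n%:R * (lam * r ^+ 2 / 16))))%:E.
  apply: (@lr_test_type2 _ _ _ s_gt0 f0 f1 f _ B (v ^+ 2)%R lam) => //.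
  - by move=> y cy; exact: sup_sqr_le n1 cy.
  (* The sup-norm hypothesis is applied to [f] itself: g^2 <= 3 r^2, so its bound is at most 3 B. *)
  - move=> y cy; apply: le_trans (sup_sqr_le Ff gE cy) _.
    rewrite /B [leRHS]mulrCA ler_pM2l// mulrDr.
    apply: lerD; last by rewrite ler_peMl ?ler1n// ltW.
    by rewrite [leRHS]mulrCA ler_wpM2l//; have := sqr_ge0 r; lra.
  - by rewrite -ler_pdivlMl// mulr1 ge_min lexx.
  - by rewrite -ler_pdivlMl// mulr1 ge_min lexx orbT.
move=> /le_trans; apply; rewrite lee_fin.
apply: (type2_rate (s := s) (eta := eta)) => //.
- by rewrite ltW// rate_const_gt0.
- by rewrite ge_min lexx.
- by rewrite ge_min lexx orbT.
- by rewrite sqr_ge0/= lerXn2r ?nnegrE.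
- by rewrite /lam minEle; case: ifP; [left|right].
Qed.

Lemma separation_test (M e : R) n : (0 < M)%R -> (0 < e)%R ->
  exists phi : n.-tuple (obs R p) -> R,
  [/\ is_test phi,
    expect s f0 phi <=
      \sum_(0 <= k <oo)
        (covering_number (8^-1 * (M + k%:R) * e)%R
           (shell F f0 e (M + k%:R)%R) (@dist2 R p) *
         (expR (- (n%:R * (C * ((M + k%:R) * e) ^+ 2))))%:E) &
    forall f, F f -> (M * e)%:E < norm2 (f \- f0)%R ->
      expect s f (fun w => 1 - phi w)%R <=
      (expR (- (n%:R * (C * (M * e) ^+ 2))) +
       2 * expR (- (n%:R * (C * ((M * e) ^+ 2 /
         (m%:R * (M * e) ^+ 2 + delta ^+ 2))))))%:E].
Proof.
move=> M0 e0.
pose cn (k : nat) := covering_number (8^-1 * (M + k%:R) * e)%R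
  (shell F f0 e (M + k%:R)%R) (@dist2 R p).
have cn0 k : 0 <= cn k by exact: covering_number_ge0.
have [[k cnk]|/forallNP cnfin] := pselect (exists k, cn k = +oo).
  exists (fun=> 1%R); split.
  - by split=> // w; rewrite ler01 lexx.
  - rewrite (@nneseries_pinfty _ _ _ k) ?leey//.
      by move=> i _; apply: mule_ge0; [exact: cn0|rewrite lee_fin expR_ge0].
    by rewrite -/(cn k) cnk mulyr gtr0_sg ?expR_gt0// mul1e.
  - move=> f Ff _.
    have -> : (fun=> 1 - 1)%R = (fun=> 0)%R :> (n.-tuple (obs R p) -> R).
      by apply/funext => w; rewrite subrr.
    by rewrite expect_cst lee_fin addr_ge0 ?mulr_ge0 ?expR_ge0.
have fN k : exists N : nat, exists c : 'I_N -> covariate R p -> R,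
    [/\ cn k = N%:R%:E, (forall i, shell F f0 e (M + k%:R)%R (c i)) &
        forall g, shell F f0 e (M + k%:R)%R g ->
          exists i, dist2 (c i) g < (8^-1 * (M + k%:R) * e)%:E].
  by apply: covering_numberP; apply/eqP; exact: cnfin.
have [N [c cP]] : exists (N : nat -> nat)
    (c : forall k, 'I_(N k) -> covariate R p -> R),
    forall k, [/\ cn k = (N k)%:R%:E,
      (forall i, shell F f0 e (M + k%:R)%R (@c k i)) &
      forall g, shell F f0 e (M + k%:R)%R g ->
        exists i, dist2 (@c k i) g < (8^-1 * (M + k%:R) * e)%:E].
  exists (fun k => sval (cid (fN k))), (fun k => sval (cid (svalP (cid (fN k))))).
  by move=> k; exact: svalP (cid (svalP (cid (fN k)))).
pose r k i : R := fine (norm2 (@c k i \- f0)%R).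
have Fc k i : F (@c k i) by have [_ /(_ i)[]] := cP k.
have mc k i : measurable_fun [set: covariate R p] (@c k i).
  by apply: Lfun_measurable; exact: LF.
have rE k i : norm2 (@c k i \- f0)%R = (r k i)%:E.
  have [t [_ tE _]] := norm2_sqr (Lfun_sub (LF (Fc k i)) Lf0).
  by rewrite /r tE.
have rk k i : ((M + k%:R) * e < r k i)%R.
  by have [_ /(_ i)[_ /andP[]]] := cP k; rewrite rE lte_fin.
pose psi k (i : 'I_(N k)) := @lr_test R p f0 (@c k i) (r k i ^+ 2)%R n.
have mf0 := Lfun_measurable Lf0.
have tpsi k i : is_test (@psi k i).
  split; first exact: measurable_lr_test.
  by move=> w; rewrite /psi /lr_test ler0n lern1 leq_b1.
(* The union of all rejection regions, countable over shells and finite over the centers of each;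
   its indicator is the combined test. *)
pose A := \bigcup_(k in [set: nat]) \bigcup_(i in [set: 'I_(N k)])
  [set w | @psi k i w = 1%R].
have mA : measurable A.
  apply: bigcup_measurable => k _; apply: fin_bigcup_measurable => // i _.
  rewrite -[X in measurable X]setTI.
  by have [mpsi _] := tpsi k i; exact: (mpsi measurableT _ (measurable_set1 1%R)).
exists (\1_A : n.-tuple (obs R p) -> R).
have tA : is_test (\1_A : n.-tuple (obs R p) -> R).
  by split; [exact: measurable_indic|move=> w; rewrite indicE ler0n lern1 leq_b1].
have psiA k i w : (@psi k i w <= \1_A w)%R.
  have [_ /(_ w)/andP[_ p1]] := tpsi k i.
  rewrite /psi /lr_test; case: ltP => /= h; last by rewrite indicE ler0n.
  rewrite indicE mem_set//; exists k => //; exists i => //=.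
  by rewrite /psi /lr_test h.
split => //.
- apply: le_trans (expect_le_series s mf0 tA tpsi _) _.
    move=> w; rewrite indicE; case: (boolP (w \in A)); last by rewrite ltxx.
    by rewrite inE => -[k _ [i _ h]] _; exists k, i.
  apply: lee_nneseries => [k _ _|k _].
    apply: sume_ge0 => i _; rewrite /expect unlock integral_ge0// => w _.
    by rewrite lee_fin; have [_ /(_ (data f0 w))/andP[]] := tpsi k i.
  rewrite -/(cn k); have [-> _ _] := cP k.
  (* Every center of shell k is farther than (M + k) e from f0, so all [N k] tests share one type I
     bound. *)
  apply: (@le_trans _ _ (\sum_(i < N k)
      (expR (- (n%:R * (C * ((M + k%:R) * e) ^+ 2))))%:E)).
    apply: lee_sum => i _.
    apply: le_trans (lr_test_type1 s_gt0 _ _ mf0 (mc k i)) _.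
    rewrite lee_fin ler_expR lerN2 ler_wpM2l// [leRHS]mulrC.
    have Mk0 : (0 <= (M + k%:R) * e)%R by rewrite mulr_ge0 ?addr_ge0// ltW.
    apply: ler_pM.
    - by rewrite ltW// rate_const_gt0.
    - exact: sqr_ge0.
    - by rewrite ge_min lexx.
    - by rewrite lerXn2r ?nnegrE// ltW//; exact: le_lt_trans (rk k i).
  by rewrite sumEFin sumr_const card_ord -EFinM lee_fin [leRHS]mulr_natl.
move=> f Ff Mf.
have [t [t0 tE _]] := norm2_sqr (Lfun_sub (LF Ff) Lf0).
have [k /andP[kl ku]] : exists k : nat, ((M + k%:R) * e < t <= (M + k%:R + 1) * e)%R.
  by apply: archimedean_shell => //; move: Mf; rewrite tE lte_fin.
have [_ _ /(_ f)[|i ci]] := cP k.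
  by split => //; rewrite tE lte_fin lee_fin kl.
(* Used with x = M e. The covering radius (M + k) e / 8 is below r / 8 because the center lies in
   the shell. *)
apply: (ball_type2 (f1 := @c k i) (r := r k i)) => //.
- rewrite mulr_ge0 ?(ltW M0) ?(ltW e0)//=; apply: le_trans (ltW (rk k i)).
  by rewrite ler_pM2r// lerDl.
- by apply: lt_trans ci _; rewrite lte_fin -mulrA ltr_pM2l.
- by move=> w; exact: (psiA k i).
Qed.

End separation.

(** * Assembly of the sequence of tests *)

Theorem lemma2p2 (R : realType) (sigma eta : R)
    (sigma_gt0 : (0 < sigma)%R) (eta_gt0 : (0 < eta)%R) :
  exists C xi : R, [/\ (0 < C)%R, (0 < xi < 1)%R &
  forall (p m : nat) (delta : R) (f0 : covariate R p -> R)
    (F : set (covariate R p -> R)) (eps : nat -> R),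
  (0 < p)%N -> (0 < m)%N -> (0 < delta)%R ->
  f0 \in Lfun (design R p) 2%:E ->
  (forall f, F f -> f \in Lfun (design R p) 2%:E) ->
  (forall f, F f ->
     norm_sup (f \- f0)%R ^+ 2 <=
     eta%:E * (m%:R%:E * norm2 (f \- f0)%R ^+ 2 + (delta ^+ 2)%:E)) ->
  (forall n, (0 < n)%N -> (0 <= eps n)%R) ->
  (n%:R * eps n ^+ 2)%R @[n --> \oo] --> +oo%R ->
  forall M : R, (0 <= M)%R ->
  exists phi : forall n, n.-tuple (obs R p) -> R,
  forall n, (0 < n)%N ->
  [/\ is_test (phi n),
    expect sigma f0 (phi n) <=
      \sum_(0 <= k <oo)
        (covering_number (xi * (M + k%:R) * eps n)%R
           (shell F f0 (eps n) (M + k%:R)%R) (@dist2 R p) *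
         (expR (- (C * n%:R * (M + k%:R) ^+ 2 * eps n ^+ 2)))%:E) &
    ereal_sup [set expect sigma f (fun D => 1 - phi n D)%R | f in
                 [set f | F f /\ (M * eps n)%:E < norm2 (f \- f0)%R]] <=
      (expR (- (C * M ^+ 2 * n%:R * eps n ^+ 2)) +
       2 * expR (- (C * M ^+ 2 * n%:R * eps n ^+ 2 /
                    (m%:R * M ^+ 2 * eps n ^+ 2 + delta ^+ 2))))%:E]].
Proof.
(* With xi = 1/8, a function within the covering radius of a center satisfies 64 ||f - f1||_2^2 <=
   ||f1 - f0||_2^2. *)
exists (rate_const sigma eta), 8^-1%R; split.
- exact: rate_const_gt0.
- by rewrite invr_gt0 ltr0n invf_lt1 ?ltr1n ?ltr0n.
set C := rate_const sigma eta.
move=> p m delta f0 F eps _ _ delta0 Lf0 LF supF eps0 _ M M0.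
(* The tests are built separately for each n and gathered by choice; with 0 < n inside the
   existential, n = 0 takes an arbitrary function. *)
suff E n : exists phi : n.-tuple (obs R p) -> R, (0 < n)%N ->
  [/\ is_test phi,
    expect sigma f0 phi <=
      \sum_(0 <= k <oo)
        (covering_number (8^-1 * (M + k%:R) * eps n)%R
           (shell F f0 (eps n) (M + k%:R)%R) (@dist2 R p) *
         (expR (- (C * n%:R * (M + k%:R) ^+ 2 * eps n ^+ 2)))%:E) &
    ereal_sup [set expect sigma f (fun D => 1 - phi D)%R | f in
                 [set f | F f /\ (M * eps n)%:E < norm2 (f \- f0)%R]] <=
      (expR (- (C * M ^+ 2 * n%:R * eps n ^+ 2)) +
       2 * expR (- (C * M ^+ 2 * n%:R * eps n ^+ 2 /
                    (m%:R * M ^+ 2 * eps n ^+ 2 + delta ^+ 2))))%:E].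
  by exists (fun n => sval (cid (E n))) => n; exact: svalP (cid (E n)).
have [->|n0] := posnP n; first by exists (fun=> 0%R).
have Meps : (0 <= M * eps n)%R by rewrite mulr_ge0// eps0.
(* If M * eps n = 0, the second bound is 1 + 2 and the zero test will do. *)
move: Meps; rewrite le_eqVlt => /predU1P[Meps|Meps].
  exists (fun=> 0%R) => _; split.
  - by split=> // w; rewrite lexx ler01.
  - rewrite expect_cst; apply: nneseries_ge0 => k _ _.
    by apply: mule_ge0; [exact: covering_number_ge0|rewrite lee_fin expR_ge0].
  - apply: ge_ereal_sup => _ [f _ <-].
    have M2 : (M ^+ 2 * eps n ^+ 2 = 0)%R by rewrite -exprMn -Meps expr0n.
    have -> : (C * M ^+ 2 * n%:R * eps n ^+ 2 = C * n%:R * (M ^+ 2 * eps n ^+ 2))%R.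
      by ring.
    rewrite expect_cst M2 mulr0 mul0r oppr0 expR0 lee_fin addr0 mulr1.
    by rewrite lerDl.
have M_gt0 : (0 < M)%R.
  by rewrite lt_neqAle M0 andbT; apply: contraTN Meps => /eqP<-; rewrite mul0r ltxx.
have eps_gt0 : (0 < eps n)%R by rewrite -(pmulr_rgt0 _ M_gt0).
have [phi [tphi phi1 phi2]] :=
  separation_test sigma_gt0 eta_gt0 delta0 Lf0 LF supF n M_gt0 eps_gt0.
exists phi => _; split => //.
- apply: le_trans phi1 _; rewrite le_eqVlt; apply/orP; left; apply/eqP.
  by apply: eq_eseriesr => k _; congr (_ * (expR _)%:E); rewrite -/C; ring.
- apply: ge_ereal_sup => _ [f [Ff Mf] <-].
  apply: le_trans (phi2 f Ff Mf) _; rewrite -/C exprMn.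
  rewrite le_eqVlt; apply/orP; left; apply/eqP; congr (_%:E).
  by congr (expR _ + 2 * expR _)%R; rewrite ?mulrA; ring.
Qed.
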